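(* Let $p=1$ and $0<\kappa<1$. Let $V\ge0$ be locally integrable on $\mathbb H^n$, $V\not\equiv0$, with $V\in RH_s$ for some $s\geq Q/2$. Then for each fixed $N\in\mathbb N$, the maximal operator $\mathcal M_{\rho,N}$ is bounded from $L^{1,\kappa}_{\rho,\theta}(\mathbb H^n)$ into $WL^{1,\kappa}_{\rho,\theta}(\mathbb H^n)$ for every $\theta$ with $0<\theta(N_0+1)\le N$.
   Context: The Heisenberg group $\mathbb H^n$ is $\mathbb C^n\times\mathbb R$ with multiplication $(z,t)\cdot(z',t')=(z+z',t+t'+2\,\mathrm{Im}(z\cdot\overline{z'}))$, $z\cdot\overline{z'}=\sum_j z_j\overline{z_j'}$; inverse $(z,t)^{-1}=(-z,-t)$; Haar measure is Lebesgue measure, $|E|$ the measure. Homogeneous norm $|(z,t)|=(|z|^4+t^2)^{1/4}$, balls $B(u,r)=\{v:|u^{-1}v|<r\}$, $Q=2n+2$. $V\in RH_s$ means $\big(\frac1{|B|}\int_B V^s\big)^{1/s}\le C\frac1{|B|}\int_B V$ for all balls. Critical radius: $\rho(u)=\sup\{r>0: r^{2-Q}\int_{B(u,r)}V\le 1\}\in(0,\infty)$. $N_0>0$ (together with $C_0\ge1$) denotes constants, which exist under these hypotheses, such that for all $u,v$: $C_0^{-1}[1+|v^{-1}u|/\rho(u)]^{-N_0}\le\rho(v)/\rho(u)\le C_0[1+|v^{-1}u|/\rho(u)]^{N_0/(N_0+1)}$. $\mathcal M_{\rho,N}f(u)=\sup_{r>0}[1+r/\rho(u)]^{-N}\frac1{|B(u,r)|}\int_{B(u,r)}|f|$.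 For $\theta>0$: $\|f\|_{L^{1,\kappa}_{\rho,\theta}}:=\sup_{B=B(u_0,r)}[1+r/\rho(u_0)]^{-\theta}|B|^{-\kappa}\int_B|f|$ and $\|f\|_{WL^{1,\kappa}_{\rho,\theta}}:=\sup_{B=B(u_0,r)}[1+r/\rho(u_0)]^{-\theta}|B|^{-\kappa}\sup_{\lambda>0}\lambda|\{u\in B:|f(u)|>\lambda\}|$; the spaces are the sets where these are finite. *)

(* Defs.v *)
From HB Require Import structures.
From mathcomp Require Import all_boot all_order all_algebra.
From mathcomp Require Import all_classical all_reals all_analysis.
Set Implicit Arguments. Unset Strict Implicit. Unset Printing Implicit Defensive.
Import Order.TTheory GRing.Theory Num.Theory.
Import numFieldNormedType.Exports.
Local Open Scope classical_set_scope.
Local Open Scope ring_scope.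

Section Heis.
Variable R : realType.

Section sfwrap.
Context d (T : measurableType d).
Definition sfwrap (m : {measure set T -> \bar R}) (h : sigma_finite setT m)
  : set T -> \bar R := m.
Variables (m : {measure set T -> \bar R}) (h : sigma_finite setT m).
HB.instance Definition _ := Measure.on (sfwrap h).
HB.instance Definition _ := Measure_isSigmaFinite.Build _ _ _ (sfwrap h) h.
End sfwrap.

(* the product of two sigma-finite measures is sigma-finite
   (copied from mathcomp-analysis, where it is a local Let) *)
Lemma prod_sigma_finite d1 d2 (T1 : measurableType d1) (T2 : measurableType d2)
  (m1 : {sigma_finite_measure set T1 -> \bar R})
  (m2 : {sigma_finite_measure set T2 -> \bar R}) :
  sigma_finite setT (m1 \x m2)%E.
Proof.
have /sigma_finiteP[F [TF ndF Foo]] := sigma_finiteT m1.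
have /sigma_finiteP[G [TG ndG Goo]] := sigma_finiteT m2.
exists (fun n => F n `*` G n).
 rewrite -setXTT TF TG predeqE => -[x y]; split.
    move=> [/= [n _ Fnx] [k _ Gky]]; exists (maxn n k) => //; split.
    - by move: x Fnx; exact/subsetPset/ndF/leq_maxl.
    - by move: y Gky; exact/subsetPset/ndG/leq_maxr.
  by move=> [n _ []/= ? ?]; split; exists n.
move=> k; have [? ?] := Foo k; have [? ?] := Goo k.
split; first exact: measurableX.
by rewrite product_measure1E// lte_mul_pinfty// ge0_fin_numE.
Qed.

Record msp := MSp {
  msp_disp : measure_display;
  msp_car : measurableType msp_disp;
  msp_mu : {sigma_finite_measure set msp_car -> \bar R} }.

(* Lebesgue measure on R^(k+1), realised as the iterated product measure
   on R * (R * ( ... * R)). *)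
Fixpoint lebn (k : nat) : msp :=
  match k with
  | 0 => @MSp _ _ (@lebesgue_measure R)
  | k'.+1 => let m := lebn k' in
             @MSp _ _ (sfwrap (prod_sigma_finite (@lebesgue_measure R) (@msp_mu m)))
  end.

Fixpoint coord (k : nat) : msp_car (lebn k) -> nat -> R :=
  match k return msp_car (lebn k) -> nat -> R with
  | 0 => fun x _ => x
  | k'.+1 => fun x i => match i with
                        | 0 => x.1
                        | i'.+1 => @coord k' x.2 i' end
  end.

Fixpoint of_coord (k : nat) : (nat -> R) -> msp_car (lebn k) :=
  match k return (nat -> R) -> msp_car (lebn k) with
  | 0 => fun c => c 0%N
  | k'.+1 => fun c => (c 0%N, @of_coord k' (fun i => c i.+1))
  end.

(* Heisenberg group H^n = C^n x R = R^(2n+1); coordinates: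
   z_j = x_j + i y_j with x_j = coord j, y_j = coord (n+j), t = coord (2n). *)
Definition Hn (n : nat) : Type := msp_car (lebn (2 * n)).
Definition Hmeas (n : nat) : set (Hn n) -> \bar R :=
  @msp_mu (lebn (2 * n)).
Arguments Hmeas : clear implicits.

Definition hx n (u : Hn n) (j : nat) : R := coord u j.
Definition hy n (u : Hn n) (j : nat) : R := coord u (n + j).
Definition ht n (u : Hn n) : R := coord u (2 * n).

(* Im (z . conj z') = sum_j (y_j x'_j - x_j y'_j) *)
Definition Im_herm n (u v : Hn n) : R :=
  \sum_(j < n) (hy u j * hx v j - hx u j * hy v j).

Definition hmul n (u v : Hn n) : Hn n :=
  @of_coord (2 * n) (fun i => if (i < 2 * n)%N then coord u i + coord v i
                           else ht u + ht v + 2 * Im_herm u v).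

Definition hinv n (u : Hn n) : Hn n := @of_coord (2 * n) (fun i => - coord u i).

Definition zabs2 n (u : Hn n) : R := \sum_(j < n) (hx u j ^+ 2 + hy u j ^+ 2).

Definition hnorm n (u : Hn n) : R := (zabs2 u ^+ 2 + ht u ^+ 2) `^ (4%:R^-1).

Definition hball n (u : Hn n) (r : R) : set (Hn n) :=
  [set v | hnorm (hmul (hinv u) v) < r].

Definition Qdim (n : nat) : R := (2 * n + 2)%:R.

(* Lebesgue measure |E| of a ball, as a real number (balls have finite measure) *)
Definition bmeas n (u : Hn n) (r : R) : R := fine (Hmeas n (hball u r)).

Local Open Scope ereal_scope.

Definition RH n (s : R) (V : Hn n -> R) : Prop :=
  exists C : R, forall (u : Hn n) (r : R), (0 < r)%R ->
    (Hmeas n).-integrable (hball u r) (fun x => (V x `^ s)%:E) /\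
    (((bmeas u r)^-1 * Rintegral (Hmeas n) (hball u r) (fun x => V x `^ s))
       `^ (s^-1) <=
     C * ((bmeas u r)^-1 * Rintegral (Hmeas n) (hball u r) V))%R.

Definition crit_rad n (V : Hn n -> R) (u : Hn n) : R :=
  sup [set r : R | (0 < r)%R /\
        (r `^ (2 - Qdim n))%:E * \int[Hmeas n]_(x in hball u r) (V x)%:E <= 1].

Definition Mrho n (V : Hn n -> R) (N : nat) (f : Hn n -> R) (u : Hn n) : \bar R :=
  ereal_sup [set y | exists r : R, (0 < r)%R /\
     y = (((1 + r / crit_rad V u) ^- N) * (bmeas u r)^-1)%:E *
         \int[Hmeas n]_(x in hball u r) (`|f x|)%:E].

(* || f ||_{L^{1,kappa}_{rho,theta}} (an extended real, finite iff f in the space) *)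
Definition Lnorm_rho n (V : Hn n -> R) (kappa theta : R) (f : Hn n -> R) : \bar R :=
  ereal_sup [set y | exists (u0 : Hn n) (r : R), (0 < r)%R /\
     y = ((1 + r / crit_rad V u0) `^ (- theta) * bmeas u0 r `^ (- kappa))%:E *
         \int[Hmeas n]_(x in hball u0 r) (`|f x|)%:E].

Definition WLnorm_rho n (V : Hn n -> R) (kappa theta : R) (g : Hn n -> \bar R) : \bar R :=
  ereal_sup [set y | exists (u0 : Hn n) (r : R), (0 < r)%R /\
     y = ((1 + r / crit_rad V u0) `^ (- theta) * bmeas u0 r `^ (- kappa))%:E *
         ereal_sup [set z | exists lam : R, (0 < lam)%R /\
            z = lam%:E * Hmeas n [set u | hball u0 r u /\ (lam%:E < `|g u|)]]].

End Heis.

(* Main.v *)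
Require Import Defs.
From HB Require Import structures.
From mathcomp Require Import all_boot all_order all_algebra.
From mathcomp Require Import finmap.
From mathcomp Require Import all_classical all_reals all_analysis.
From mathcomp Require Import measurable_realfun ring lra zify.
Import Order.TTheory GRing.Theory Num.Theory.
Import numFieldNormedType.Exports.
Local Open Scope classical_set_scope.
Local Open Scope ring_scope.

(* Let [A] be the Morrey norm of [f] and let [B = B(u0, r)].  If the average defining
   [Mrho f u] exceeds [lam] at some radius [R > r], the Morrey bound on [B(u, R)], together with
   [theta <= N] and [kappa < 1], gives [lam < A |B|^(kappa - 1)]; then the trivial estimate
   [lam |B| <= A |B|^kappa] suffices.  Otherwise every point of the level set in [B] is the
   center of a ball of radius at most [r] on which the average of [|f|] exceeds [lam]; the Vitali
   covering lemma for the (quasi-)metric balls bounds [lam] times the measure of the level set by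
   a constant times the integral of [|f|] over [B(u0, 4r)], to which the Morrey bound applies.
   Doubling comes from [|B(u, r)| = r^Q |B(0, 1)|].  The only property of the critical radius
   that enters is its positivity. *)

(** * The iterated Lebesgue measure *)

(** A nonnegative integral is a supremum over the simple functions below the integrand, and a larger
    integrand admits more of them; this holds for arbitrary functions. *)
Lemma le_integral_nonmeasurable {d} {T : measurableType d} {R : realType}
    (mu : {measure set T -> \bar R}) (f g : T -> \bar R) :
  (forall x, 0 <= f x)%E -> (forall x, f x <= g x)%E ->
  (\int[mu]_x f x <= \int[mu]_x g x)%E.
Proof.
move=> f0 fg; have g0 x : (0 <= g x)%E := le_trans (f0 x) (fg x).
rewrite !ge0_integralTE//; apply: le_ereal_sup => _ [h hf <-].
by exists h => // x; apply: le_trans (fg x).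
Qed.

(* Level sets of the maximal function are not shown to be measurable, so monotonicity is
   needed on arbitrary sets: off the sigma-algebra, Lebesgue measure is still an outer measure
   and the product measure still a supremum over simple functions below the sections. *)
Lemma lebn_le_measure {R : realType} (k : nat) (A B : set (msp_car (lebn R k))) :
  A `<=` B -> (msp_mu (lebn R k) A <= msp_mu (lebn R k) B)%E.
Proof.
elim: k A B => [|k IH] A B AB; first exact: le_outer_measure.
apply: (le_integral_nonmeasurable lebesgue_measure) => x //=.
apply: IH => y; rewrite /xsection/= !inE; exact: AB.
Qed.

Section affine.
Context {R : realType}.
Implicit Types (s a : R).

(** By uniqueness of Lebesgue measure: [s] times the pushforward gives each half-open interval its
    length, since []u, v]] has preimage [](u - a) / s, (v - a) / s]]. *)
Lemma lebesgue_measure_affine (s a : R) (A : set (measurableTypeR R)) :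
  0 < s -> measurable A ->
  pushforward lebesgue_measure (fun x => s * x + a : measurableTypeR R) A =
  ((s^-1)%:E * lebesgue_measure A)%E.
Proof.
move=> s0 mA.
have maff : measurable_fun setT (fun x : measurableTypeR R => s * x + a : measurableTypeR R).
  by apply: measurable_funD => //; apply: measurable_funM.
have si0 : 0 <= s by rewrite ltW.
pose nn := NngNum si0.
pose pm := measure_function_pushforward__canonical__measure_function_Measure lebesgue_measure maff.
have /= := @lebesgue_measure_unique R (mscale nn pm).
rewrite /mscale/= => ->//; first by rewrite muleA -EFinM mulVf ?mul1e// gt_eqF.
move=> _ [[u v]] _ <-; rewrite /pushforward/=.
rewrite (_ : _ @^-1` _ = `](u - a) / s, (v - a) / s]%classic); last first.
  apply/seteqP; split=> x /=; rewrite !in_itv/= ltr_pdivrMr// ler_pdivlMr//.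
    by rewrite ltrBlDr lerBrDr [x * s]mulrC.
  by rewrite ltrBlDr lerBrDr [x * s]mulrC.
rewrite !lebesgue_measure_itv/= !lte_fin ltr_pM2r ?invr_gt0//.
rewrite ltrD2r; case: ifP => _; last by rewrite mule0.
rewrite -!EFinB -EFinM -mulrBl; congr EFin; field.
by rewrite gt_eqF.
Qed.

Lemma ge0_integral_affine (s a : R) (f : measurableTypeR R -> \bar R) :
  0 < s -> measurable_fun setT f -> (forall x, 0 <= f x)%E ->
  (\int[lebesgue_measure]_x f (s * x + a)%R =
   (s^-1)%:E * \int[lebesgue_measure]_x f x)%E.
Proof.
move=> s0 mf f0.
have maff : measurable_fun setT (fun x : measurableTypeR R => s * x + a : measurableTypeR R).
  by apply: measurable_funD => //; apply: measurable_funM.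
have si0 : 0 <= s^-1 by rewrite invr_ge0 ltW.
rewrite -[RHS](@ge0_integral_mscale _ _ _ lebesgue_measure setT measurableT (NngNum si0))//.
have := @ge0_integral_pushforward _ _ _ _ R _ maff lebesgue_measure setT f measurableT mf (fun x _ => f0 x).
rewrite preimage_setT => /= <-.
apply: (@eq_measure_integral _ _ _ setT _ (measure_function_pushforward__canonical__measure_function_Measure lebesgue_measure maff)) => A mA _.
exact: lebesgue_measure_affine.
Qed.

End affine.

Local Notation coord := Defs.coord.

Section lebn_coordinates.
Context {R : realType}.
Implicit Types k : nat.

Lemma coord_of_coord k (c : nat -> R) (i : nat) :
  (i <= k)%N -> coord (of_coord k c) i = c i.
Proof.
elim: k c i => [|k IH] c [|i]//= ik.
exact: (IH (fun j => c j.+1)).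
Qed.

Lemma measurable_coord k (i : nat) :
  measurable_fun setT (fun v : msp_car (lebn R k) => coord v i : R).
Proof.
elim: k i => [|k IH] i /=; first exact: measurable_id.
case: i => [|i] /=; first exact: measurable_fst.
exact: measurableT_comp (IH i) measurable_snd.
Qed.

(* Triangular affine maps: only the last coordinate mixes, by the linear form [c]; these
   include both the left translations and the dilations of the Heisenberg group. *)
Fixpoint shear k (s a c : nat -> R) (b : R) : msp_car (lebn R k) -> msp_car (lebn R k) :=
  match k return msp_car (lebn R k) -> msp_car (lebn R k) with
  | 0 => fun x => s 0%N * x + b
  | k'.+1 => fun x =>
      (s 0%N * x.1 + a 0%N,
       shear k' (fun i => s i.+1) (fun i => a i.+1) (fun i => c i.+1)
         (b + c 0%N * x.1) x.2)
  end.

Lemma coord_shear_lt k s a c b (v : msp_car (lebn R k)) (i : nat) :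
  (i < k)%N -> coord (shear k s a c b v) i = s i * coord v i + a i.
Proof.
elim: k s a c b v i => [//|k IH] s a c b v [|i]//= ik.
exact: (IH (fun i => s i.+1)).
Qed.

(** Each recursive call adds one term of the linear form to [b], which only the last coordinate
    receives. *)
Lemma coord_shear_last k s a c b (v : msp_car (lebn R k)) :
  coord (shear k s a c b v) k =
  s k * coord v k + b + \sum_(i < k) c i * coord v i.
Proof.
elim: k s a c b v => [|k IH] s a c b v /=; first by rewrite big_ord0 addr0.
rewrite (IH (fun i => s i.+1)) big_ord_recl/=; ring.
Qed.

(** Induction through sections: over a fixed first coordinate [x] the preimage is a shear preimage
    in one dimension less, with offset [b + c 0 * x]. Its measure does not depend on the offset, and
    an affine change of variable in [x] supplies the remaining factor. *)
Lemma lebn_preimage_shear k s a c b (A : set (msp_car (lebn R k))) :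
  (forall i, (i <= k)%N -> 0 < s i) -> measurable A ->
  msp_mu (lebn R k) (shear k s a c b @^-1` A) =
  ((\prod_(i < k.+1) s i)^-1%:E * msp_mu (lebn R k) A)%E.
Proof.
elim: k s a c b A => [|k IH] s a c b A s0 mA.
  by rewrite big_ord_recl big_ord0 mulr1; apply: lebesgue_measure_affine => //; exact: s0.
rewrite big_ord_recl /=.
set p := \prod_(i < k.+1) _.
have p0 : 0 < p by apply: prodr_gt0 => i _; apply: s0; rewrite /= /bump/= add1n ltn_ord.
have mx := measurable_fun_xsection (msp_mu (lebn R k)) mA.
rewrite /sfwrap /product_measure1/=.
transitivity (\int[lebesgue_measure]_(x in [set: measurableTypeR R])
   ((p^-1)%:E * msp_mu (lebn R k) (xsection A (s 0%N * x + a 0%N)%R)))%E.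
  apply: eq_integral => x _ /=.
  rewrite -(IH (fun i => s i.+1) (fun i => a i.+1) (fun i => c i.+1) (b + c 0%N * x)).
  - congr (msp_mu _ _); apply/seteqP; split=> y; by rewrite /xsection/= !inE.
  - by move=> i ik; apply: s0.
  - exact: measurable_xsection.
rewrite (ge0_integral_affine (s 0%N) (a 0%N)
  (fun x => ((p^-1)%:E * msp_mu (lebn R k) (xsection A x)))%E) ?s0//; last 2 first.
- exact: measurable_funeM.
- by move=> x; apply: mule_ge0 => //; rewrite lee_fin invr_ge0 ltW.
rewrite ge0_integralZl//; last by rewrite lee_fin invr_ge0 ltW.
by rewrite muleA -EFinM invfM.
Qed.

(** These cubes bound the unit ball from outside and from inside. *)
Lemma lebn_box k (e : R) : 0 < e ->
  msp_mu (lebn R k) [set v | forall i, (i <= k)%N -> `|coord v i| < e] =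
  ((2 * e) ^+ k.+1)%:E.
Proof.
move=> e0.
have I1 : lebesgue_measure [set x : measurableTypeR R | `|x| < e] = (2 * e)%:E.
  rewrite (_ : [set _ | _] = `]- e, e[%classic); last first.
    by apply/seteqP; split=> x /=; rewrite in_itv/= ltr_norml.
  by rewrite lebesgue_measure_itv/= lte_fin ifT ?gtrN// -EFinB opprK mulr2n mulrDl mul1r.
elim: k => [|k IH].
  rewrite expr1 -I1; congr (msp_mu _ _); apply/seteqP; split=> x /=.
    by move=> h; exact: (h 0%N).
  by move=> xe i _.
rewrite (_ : [set _ | _] = [set x : measurableTypeR R | `|x| < e] `*`
  [set v : msp_car (lebn R k) | forall i, (i <= k)%N -> `|coord v i| < e]); last first.
  apply/seteqP; split=> -[x v] /=.
    by move=> h; split; [exact: (h 0%N)|move=> i ik; exact: (h i.+1)].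
  by move=> [h1 h2] [|i] //= ik; exact: h2.
rewrite /= /sfwrap product_measure1E//=.
- by rewrite I1 IH -EFinM -exprS.
- rewrite (_ : [set _ | _] = `]- e, e[%classic)//.
  by apply/seteqP; split=> x /=; rewrite in_itv/= ltr_norml.
- rewrite (_ : [set _ | _] = \bigcap_(i in [set i | (i <= k)%N])
    ((fun v : msp_car (lebn R k) => coord v i) @^-1` `]- e, e[%classic)).
    apply: bigcap_measurable; first by exists 0%N.
    move=> i _; rewrite -[X in measurable X]setTI; exact: measurable_coord.
  by apply/seteqP; split=> v /= h i ik; have := h i ik; rewrite /= in_itv/= ltr_norml.
Qed.

End lebn_coordinates.

(** * Covering by disjoint families *)

Lemma vitali_disjoint_subfamily {R : realType} {I T : Type} (B : I -> set T)
    (rad : I -> R) (E : set I) (M : R) :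
  (forall i, E i -> 0 < rad i <= M) -> (forall i, E i -> B i !=set0) ->
  exists D : set I, [/\ D `<=` E, trivIset D B &
    forall i, E i -> exists j, [/\ D j, B i `&` B j !=set0 & rad i <= 2 * rad j]].
Proof.
move=> radE B0.
(* Zorn on the disjoint families [D] such that every set meeting [D] meets a member of [D] of at
   least half its radius; a set missing a maximal [D] would let one add a set of nearly
   maximal radius among those missing [D]. *)
pose P (D : set I) := [/\ D `<=` E, trivIset D B &
  forall i j, E i -> D j -> B i `&` B j !=set0 ->
    exists k, [/\ D k, B i `&` B k !=set0 & rad i <= 2 * rad k]].
have [|D [[DE tD Dcov] Dmax]] := @Zorn_bigcup _ P.
  move=> F FP Ftot; split.
  - by move=> i [X FX Xi]; have [XE _ _] := FP _ FX; exact: XE.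
  - move=> i j [X FX Xi] [Y FY Yj].
    have [[_ tX _] [_ tY _]] := (FP _ FX, FP _ FY).
    by case: (Ftot _ _ FX FY) => [XY|YX]; [apply: tY => //; exact: XY|apply: tX => //; exact: YX].
  - move=> i j Ei [X FX Xj] ij; have [_ _ XP] := FP _ FX.
    by have [k [Xk ik rk]] := XP _ _ Ei Xj ij; exists k; split => //; exists X.
exists D; split => // i Ei.
have [[j [Dj ij]]|noj] := pselect (exists j, D j /\ B i `&` B j !=set0).
  exact: Dcov ij.
pose J := [set k | E k /\ forall j, D j -> ~ (B k `&` B j !=set0)].
pose S := rad @` J.
have Ji : J i by split => // j Dj ij; apply: noj; exists j.
have hS : has_sup S.
  split; first by exists (rad i), i.
  by exists M => _ [k [Ek _] <-]; case/andP: (radE _ Ek).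
have supS0 : 0 < sup S.
  apply: lt_le_trans (ub_le_sup hS.2 _); last by exists i; [exact: Ji|reflexivity].
  by case/andP: (radE _ Ei).
(* The tolerance [sup S / 2] yields [rad k > sup S / 2]. Any index whose set misses [D] has radius
   at most [sup S], hence at most [2 * rad k]: this is the factor 2. *)
have [_ [k [Ek Jk] <-] supk] := sup_adherent (divr_gt0 supS0 (ltr0Sn R 1)) hS.
exfalso; apply: (Dmax (D `|` [set k])).
  split; first by left.
  move=> /(_ k (or_intror erefl)) Dk; apply: (Jk _ Dk).
  by rewrite setIid; exact: B0.
split.
- by move=> j [/DE//|->].
- move=> p q [Dp|->] [Dq|->] // pq; first exact: tD.
    by exfalso; apply: (Jk _ Dp); rewrite setIC.
  by exfalso; exact: (Jk _ Dq).
- move=> p q Ep Dq pq.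
  have [[j [Dj pj]]|nopj] := pselect (exists j, D j /\ B p `&` B j !=set0).
    by have [l [Dl pl rl]] := Dcov _ _ Ep Dj pj; exists l; split => //; left.
  case: Dq => [Dq|qk]; first by exfalso; apply: nopj; exists q.
  rewrite qk/= in pq; exists k; split => //; first by right.
  have : rad p <= sup S.
    by apply: (ub_le_sup hS.2); exists p => //; split => // j Dj pj; apply: nopj; exists j.
  lra.
Qed.

Section disjoint_families.
Context {d : measure_display} {T : measurableType d} {R : realType}.
Variable mu : {measure set T -> \bar R}.

(** For each [n], only finitely many disjoint subsets of [X] have measure at least [1/(n+1)], and
    positivity puts every index into one of these finite classes. *)
Lemma countable_disjoint_positive {I : choiceType} (D : set I) (B : I -> set T)
    (X : set T) :
  measurable X -> (mu X < +oo)%E -> trivIset D B ->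
  (forall i, D i -> [/\ measurable (B i), B i `<=` X & (0 < mu (B i))%E]) ->
  countable D.
Proof.
move=> mX Xoo tD BD.
pose Dn n := [set i | D i /\ (n.+1%:R^-1%:E <= mu (B i))%E].
have Dfin n : finite_set (Dn n).
  apply: contrapT => /infinite_set_fset inf.
  have Xfin : mu X \is a fin_num by rewrite ge0_fin_numE.
  (* More than [mu X * (n + 1)] disjoint sets of measure at least [1/(n+1)] would together exceed
     [mu X]. *)
  have [A AD cA] := inf (Num.truncn (fine (mu X) * n.+1%:R)).+1.
  have AD' (i : I) : [set` A] i -> D i by move=> /AD[].
  have : (mu (\bigcup_(i in [set` A]) B i) <= mu X)%E.
    apply: le_measure; rewrite ?inE//.
      apply: fin_bigcup_measurable => // i /AD' Di; by have [] := BD _ Di.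
    by move=> x [i /AD' Di Bx]; have [_ BX _] := BD _ Di; exact: BX.
  rewrite measure_fin_bigcup//; last 2 first.
  - by apply: sub_trivIset tD.
  - by move=> i /AD' Di; have [] := BD _ Di.
  apply/negP; rewrite -ltNge.
  have : forall i, [set` A] i -> ((n.+1%:R^-1)%:E <= mu (B i))%E by move=> i /AD[].
  move=> /(@lee_fsum R I [set` A] (fun=> n.+1%:R^-1%:E) (fun i => mu (B i)) (finite_fset A)).
  apply: lt_le_trans.
  rewrite fsbig_finite//= set_fsetK sumEFin -(fineK Xfin) lte_fin.
  rewrite big_const_seq count_predT iter_addr_0 -[ltRHS]mulr_natl ltr_pdivlMr//.
  apply: lt_le_trans (truncnS_gt _) _; rewrite ler_nat.
  exact: cA.
rewrite (_ : D = \bigcup_n Dn n); last first.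
  apply/seteqP; split => [i Di|i [n _ []//]].
  have [_ BX B0] := BD _ Di.
  have [m mfin] : exists n : nat, (n.+1%:R^-1%:E <= mu (B i))%E.
    have [r|] := eqVneq (mu (B i)) +oo%E; first by exists 0%N; rewrite r leey.
    move=> Bfin; have Bf : mu (B i) \is a fin_num by rewrite ge0_fin_numE ?ltey.
    exists (Num.truncn (fine (mu (B i)))^-1).
    have f0 : 0 < fine (mu (B i)) by rewrite fine_gt0 // B0 ltey.
    rewrite -(fineK Bf) lee_fin -[leRHS]invrK lef_pV2 ?posrE ?invr_gt0//.
    exact: ltW (truncnS_gt _).
  by exists m.
by apply: bigcup_countable => // n _; exact: finite_set_countable.
Qed.

(** Subadditivity handles the possibly overlapping [B' i]. After the comparison with [c * mu (B i)],
    disjointness of the [B i] adds their integrals up to at most the integral over [X]. *)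
Lemma disjoint_family_bound {I : choiceType} (D : set I) (B B' : I -> set T)
    (X : set T) (g : T -> \bar R) (lam c : R) :
  countable D -> trivIset D B -> measurable X -> 0 <= lam -> 0 <= c ->
  (forall i, D i -> [/\ measurable (B i), measurable (B' i), B i `<=` X,
     (mu (B' i) <= c%:E * mu (B i))%E &
     (lam%:E * mu (B i) <= \int[mu]_(x in B i) g x)%E]) ->
  measurable_fun setT g -> (forall x, 0 <= g x)%E ->
  measurable (\bigcup_(i in D) B' i) /\
  (lam%:E * mu (\bigcup_(i in D) B' i) <= c%:E * \int[mu]_(x in X) g x)%E.
Proof.
move=> /countable_injP[e einj] tD mX lam0 c0 BD mg g0.
(* The injection [e] numbers the indices: [Dk k] is empty or the single index numbered [k], so that
   sums and unions run over the naturals. *)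
pose Dk k := D `&` [set i | e i = k].
pose F k := \bigcup_(i in Dk k) B i.
pose F' k := \bigcup_(i in Dk k) B' i.
have DkP k : Dk k = set0 \/ exists2 i, D i & Dk k = [set i].
  have [->|/set0P[i [Di ei]]] := eqVneq (Dk k) set0; [by left|right].
  exists i => //; apply/seteqP; split => [j [Dj ej]|j ->]; last by split.
  by apply: einj; rewrite ?inE// ei.
have FF' k : [/\ measurable (F k), measurable (F' k), F k `<=` X,
     (mu (F' k) <= c%:E * mu (F k))%E &
     (lam%:E * mu (F k) <= \int[mu]_(x in F k) g x)%E].
  rewrite /F /F'; have [->|[i Di ->]] := DkP k.
    by rewrite !bigcup_set0 measure0 !mule0 integral_set0; split.
  by rewrite !bigcup_set1; exact: BD.
have tF : trivIset setT F.
  move=> p q _ _ [x [[i [Di <-] Bi] [j [Dj <-] Bj]]].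
  by congr e; apply: tD => //; exists x.
have -> : \bigcup_(i in D) B' i = \bigcup_k F' k.
  apply/seteqP; split => [x [i Di Bx]|x [k _ [i [Di _] Bx]]]; last by exists i.
  by exists (e i) => //; exists i.
have mF' : measurable (\bigcup_k F' k).
  by apply: bigcup_measurable => k _; have [] := FF' k.
have mF : measurable (\bigcup_k F k).
  by apply: bigcup_measurable => k _; have [] := FF' k.
split => //.
have FX : \bigcup_k F k `<=` X by move=> x [k _ Fx]; have [_ _ FX _ _] := FF' k; exact: FX.
apply: (@le_trans _ _ (c%:E * \int[mu]_(x in \bigcup_k F k) g x)%E); last first.
  apply: lee_wpmul2l; first by rewrite lee_fin.
  by apply: ge0_subset_integral => //; exact: measurable_funTS.
rewrite ge0_integral_bigcup//; last 2 first.
- by move=> k; have [] := FF' k.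
- exact: measurable_funTS.
apply: (@le_trans _ _ (lam%:E * \sum_(k <oo) mu (F' k))%E).
  apply: lee_wpmul2l; first by rewrite lee_fin.
  by apply: generalized_Boole_inequality => // k; have [] := FF' k.
rewrite -!nneseriesZl//; last by move=> k _; exact: integral_ge0.
apply: lee_nneseries => [k _ _|k _].
  by apply: mule_ge0 => //; rewrite lee_fin.
have [_ _ _ h1 h2] := FF' k.
apply: (@le_trans _ _ (lam%:E * (c%:E * mu (F k)))%E).
  by apply: lee_wpmul2l => //; rewrite lee_fin.
by rewrite muleCA; apply: lee_wpmul2l => //; rewrite lee_fin.
Qed.

End disjoint_families.

(** * Balls of the Heisenberg group *)

Section Heisenberg_balls.
Context {R : realType} {n : nat}.
Implicit Types (u v w : Hn R n) (r : R).

(** [zdist2 u v] and [tdist u v] are [|z|^2] and [t] for the point [(z, t) = u^-1 v]. *)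
Definition zdist2 u v : R :=
  \sum_(j < n) ((hx v j - hx u j) ^+ 2 + (hy v j - hy u j) ^+ 2).

Definition tdist u v : R :=
  ht v - ht u + 2 * \sum_(j < n) (hx u j * hy v j - hy u j * hx v j).

Lemma zdist2_ge0 u v : 0 <= zdist2 u v.
Proof. by apply: sumr_ge0 => j _; rewrite addr_ge0 ?sqr_ge0. Qed.

Lemma hnorm_hmul_hinv u v :
  hnorm (hmul (hinv u) v) = (zdist2 u v ^+ 2 + tdist u v ^+ 2) `^ 4%:R^-1.
Proof.
have lt_x (j : 'I_n) : (j < 2 * n)%N by rewrite (leq_trans (ltn_ord j)) ?leq_pmull.
have lt_y (j : 'I_n) : (n + j < 2 * n)%N by rewrite mul2n -addnn ltn_add2l.
have zE : zabs2 (hmul (hinv u) v) = zdist2 u v.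
  apply: eq_bigr => j _; rewrite /hx /hy /hmul /hinv.
  rewrite !coord_of_coord ?lt_x ?lt_y ?(ltnW (lt_x j)) ?(ltnW (lt_y j))//.
  by rewrite addrC [X in _ + X ^+ 2]addrC; ring.
have tE : ht (hmul (hinv u) v) = tdist u v.
  rewrite {1}/ht /hmul coord_of_coord// ltnn /tdist /Im_herm.
  congr (_ + 2 * _); first by rewrite /ht /hinv coord_of_coord// addrC.
  apply: eq_bigr => j _; rewrite /hx /hy /hinv.
  by rewrite !coord_of_coord ?(ltnW (lt_x j)) ?(ltnW (lt_y j))//; ring.
by rewrite /hnorm zE tE.
Qed.

(** Taking fourth powers turns membership in a ball into a polynomial inequality in the
    coordinates. *)
Lemma hballP u r v : 0 < r ->
  hball u r v <-> zdist2 u v ^+ 2 + tdist u v ^+ 2 < r ^+ 4.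
Proof.
move=> r0; rewrite /hball/= hnorm_hmul_hinv.
set q := (_ + _); have q0 : 0 <= q by rewrite addr_ge0 ?sqr_ge0.
rewrite -[X in _ < X](_ : (r ^+ 4) `^ 4%:R^-1 = r); last first.
  by rewrite -powR_mulrn ?ltW// -powRrM mulfV// powRr1// ltW.
split; last by apply: gt0_ltr_powR; rewrite ?nnegrE ?exprn_ge0 ?(ltW r0)// invr_gt0.
apply: contraTT; rewrite -!leNgt; apply: ge0_ler_powR.
all: by rewrite ?nnegrE ?exprn_ge0 ?(ltW r0)// invr_ge0.
Qed.

Lemma hball_center u r : 0 < r -> hball u r u.
Proof.
move=> r0; apply/hballP => //; rewrite /zdist2 /tdist.
rewrite big1 ?big1 => [|j _|j _]; last 2 first.
- by rewrite mulrC subrr.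
- by rewrite !subrr expr0n addr0.
by rewrite subrr mulr0 addr0 expr0n addr0 exprn_gt0.
Qed.

(** Exchanging the two points preserves [zdist2] and changes the sign of [tdist]. *)
Lemma hball_sym u v r : 0 < r -> hball u r v -> hball v r u.
Proof.
move=> r0 /hballP-/(_ r0) uv; apply/hballP => //; apply: le_lt_trans uv.
rewrite (_ : zdist2 v u = zdist2 u v); last first.
  by apply: eq_bigr => j _; ring.
rewrite (_ : tdist v u = - tdist u v) ?sqrrN// /tdist opprD opprB -mulrN.
by rewrite -sumrN; congr (_ + 2 * _); apply: eq_bigr => j _; ring.
Qed.

Lemma zdist2_triangle u v w : zdist2 u w <= 2 * (zdist2 u v + zdist2 v w).
Proof.
rewrite /zdist2 -big_split/= mulr_sumr; apply: ler_sum => j _.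
set a := hx u j; set b := hx v j; set c := hx w j.
set a' := hy u j; set b' := hy v j; set c' := hy w j.
by have := sqr_ge0 (c - b - (b - a)); have := sqr_ge0 (c' - b' - (b' - a')); nra.
Qed.

(* [om] below is, up to sign, [2 Im] of the Hermitian product of the increments [v - u] and
   [w - v], bounded termwise by AM-GM. *)
Lemma tdist_triangle u v w :
  `|tdist u w| <= `|tdist u v| + `|tdist v w| + (zdist2 u v + zdist2 v w).
Proof.
pose om := \sum_(j < n) 2 * ((hy v j - hy u j) * (hx w j - hx v j) -
                         (hx v j - hx u j) * (hy w j - hy v j)).
have -> : tdist u w = tdist u v + tdist v w + om.
  have h : 2 * \sum_(j < n) (hx u j * hy w j - hy u j * hx w j) =
    2 * \sum_(j < n) (hx u j * hy v j - hy u j * hx v j) +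
    2 * \sum_(j < n) (hx v j * hy w j - hy v j * hx w j) + om.
    by rewrite !mulr_sumr -!big_split/=; apply: eq_bigr => j _; ring.
  by rewrite /tdist h; ring.
apply: le_trans (ler_normD _ _) _; apply: lerD; first exact: ler_normD.
apply: le_trans (ler_norm_sum _ _ _) _.
rewrite /zdist2 -big_split/=; apply: ler_sum => j _.
set a := hx v j - _; set b := hy w j - _; set c := hy v j - _; set e := hx w j - _.
have := sqr_ge0 (a - b); have := sqr_ge0 (a + b).
have := sqr_ge0 (c - e); have := sqr_ge0 (c + e).
by rewrite ler_norml => *; apply/andP; split; nra.
Qed.

Lemma hball_components u r v : 0 < r -> hball u r v ->
  zdist2 u v <= r ^+ 2 /\ `|tdist u v| <= r ^+ 2.
Proof.
move=> r0 /hballP-/(_ r0); rewrite (_ : r ^+ 4 = (r ^+ 2) ^+ 2); last by rewrite -exprM.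
have r2 : 0 <= r ^+ 2 by rewrite sqr_ge0.
move=> h; split.
  rewrite -(ler_pXn2r (n := 2)) ?nnegrE ?zdist2_ge0//.
  by apply: le_trans (ltW h); rewrite lerDl sqr_ge0.
rewrite -(ler_pXn2r (n := 2)) ?nnegrE//.
by rewrite real_normK ?num_real//; apply: le_trans (ltW h); rewrite lerDr sqr_ge0.
Qed.

(** With [s = r^2 + r'^2], both [zdist2] and [|tdist|] are at most [2s], so the fourth power of the
    norm is at most [8 s^2 < 16 (r + r')^4]; hence the quasi-metric constant 2. *)
Lemma hball_trans u v w r r' : 0 < r -> 0 < r' ->
  hball u r v -> hball v r' w -> hball u (2 * (r + r')) w.
Proof.
move=> r0 r'0 /(hball_components _ _ _ r0)[z1 t1] /(hball_components _ _ _ r'0)[z2 t2].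
apply/hballP; first by rewrite mulr_gt0 ?addr_gt0.
have zz := zdist2_triangle u v w; have tt := tdist_triangle u v w.
have z0 := zdist2_ge0 u w.
set s := r ^+ 2 + r' ^+ 2.
have zs : zdist2 u w <= 2 * s by rewrite /s; lra.
have ts : `|tdist u w| <= 2 * s by rewrite /s; lra.
have s0 : 0 < s by rewrite /s addr_gt0 ?exprn_gt0.
have sr : s < (r + r') ^+ 2 by rewrite /s sqrrD; have := mulr_gt0 r0 r'0; lra.
have t2s : tdist u w ^+ 2 <= (2 * s) ^+ 2.
  by rewrite -(real_normK (num_real (tdist u w))) ler_pXn2r ?nnegrE//; lra.
have z2s : zdist2 u w ^+ 2 <= (2 * s) ^+ 2 by rewrite ler_pXn2r ?nnegrE//; lra.
have -> : (2 * (r + r')) ^+ 4 = 16 * ((r + r') ^+ 2) ^+ 2 by ring.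
have : s ^+ 2 < ((r + r') ^+ 2) ^+ 2 by rewrite ltr_pXn2r ?nnegrE//; lra.
have : 0 < s ^+ 2 by rewrite exprn_gt0.
by move: t2s z2s; rewrite exprMn; lra.
Qed.

Lemma measurable_hball u r : 0 < r -> measurable (hball u r).
Proof.
move=> r0.
have mc (i : nat) : measurable_fun setT (fun v : Hn R n => coord v i : R).
  exact: measurable_coord.
have mz : measurable_fun setT (fun v : Hn R n => zdist2 u v).
  apply: measurable_sum => j; apply: measurable_funD.
    by apply: measurable_funX; apply: measurable_funB => //; exact: mc.
  by apply: measurable_funX; apply: measurable_funB => //; exact: mc.
have mt : measurable_fun setT (fun v : Hn R n => tdist u v).
  apply: measurable_funD; first by apply: measurable_funB => //; exact: mc.
  apply: measurable_funM => //; apply: measurable_sum => j.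
  apply: measurable_funB; apply: measurable_funM => //; exact: mc.
rewrite (_ : hball u r = (fun v => zdist2 u v ^+ 2 + tdist u v ^+ 2) @^-1` `]-oo, r ^+ 4[%classic).
  rewrite -[X in measurable X]setTI.
  suff : measurable_fun setT (fun v => zdist2 u v ^+ 2 + tdist u v ^+ 2) by apply.
  by apply: measurable_funD; apply: measurable_funX.
by apply/seteqP; split=> v /=; rewrite in_itv/=; [move/hballP; apply|move=> h; apply/hballP].
Qed.

(** * Volume of the balls *)

Definition hunit : set (Hn R n) :=
  [set v | zabs2 v ^+ 2 + ht v ^+ 2 < 1].

(* The unit ball is the preimage of [hball u r] under [w |-> u * delta_r w]. *)
Lemma Hmeas_hball u r : 0 < r ->
  @Hmeas R n (hball u r) = ((r ^+ (2 * n + 2))%:E * @Hmeas R n hunit)%E.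
Proof.
move=> r0.
(* The dilation scales [z] by [r] and [t] by [r^2], which gives the exponent [2n + 2]. The form [c]
   is the cross term [2 Im] of the group law between [u] and the dilated point: coefficient
   [2 r y_j] on [x_j] and [- 2 r x_j] on [y_j]. *)
pose s i := if (i < 2 * n)%N then r else r ^+ 2.
pose c i := if (i < n)%N then 2 * r * coord u (n + i)
            else - (2 * r * coord u (i - n)%N).
pose phi := shear (2 * n) s (coord u) c (ht u).
have lt_x (j : 'I_n) : (j < 2 * n)%N by rewrite (leq_trans (ltn_ord j)) ?leq_pmull.
have lt_y (j : 'I_n) : (n + j < 2 * n)%N by rewrite mul2n -addnn ltn_add2l.
have phix w (j : 'I_n) : hx (phi w) j = r * hx w j + hx u j.
  by rewrite /hx /phi coord_shear_lt ?lt_x// /s lt_x.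
have phiy w (j : 'I_n) : hy (phi w) j = r * hy w j + hy u j.
  by rewrite /hy /phi coord_shear_lt ?lt_y// /s lt_y.
have phit w : ht (phi w) = r ^+ 2 * ht w + ht u +
    2 * r * \sum_(j < n) (hy u j * hx w j - hx u j * hy w j).
  rewrite /ht /phi coord_shear_last /s ltnn; congr (_ + _).
  have nn (F : nat -> R) : \sum_(i < 2 * n) F i = \sum_(i < n + n) F i.
    by rewrite mul2n addnn.
  rewrite (nn (fun i => c i * coord w i)).
  rewrite big_split_ord/= -big_split/= mulr_sumr; apply: eq_bigr => j _.
  rewrite /c ltn_ord ltnNge leq_addr/= addKn /hx /hy; ring.
have phiz w : zdist2 u (phi w) = r ^+ 2 * zabs2 w.
  by rewrite /zdist2 /zabs2 mulr_sumr; apply: eq_bigr => j _; rewrite phix phiy; ring.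
have phid w : tdist u (phi w) = r ^+ 2 * ht w.
  rewrite /tdist phit.
  have -> : \sum_(j < n) (hx u j * hy (phi w) j - hy u j * hx (phi w) j) =
      - (r * \sum_(j < n) (hy u j * hx w j - hx u j * hy w j)).
    by rewrite mulr_sumr -sumrN; apply: eq_bigr => j _; rewrite phix phiy; ring.
  ring.
have pre : phi @^-1` hball u r = hunit.
  apply/seteqP; split => w /=.
    move=> /hballP-/(_ r0); rewrite phiz phid !exprMn -mulrDr -exprD.
    by rewrite -[ltRHS]mulr1 ltr_pM2l// exprn_gt0.
  move=> h; apply/hballP => //; rewrite phiz phid !exprMn -mulrDr -exprD.
  by rewrite -[ltRHS]mulr1 ltr_pM2l// exprn_gt0.
have s0 i : (i <= 2 * n)%N -> 0 < s i by rewrite /s; case: ifP; rewrite ?exprn_gt0.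
have := lebn_preimage_shear (2 * n) s (coord u) c (ht u) (hball u r) s0 (measurable_hball u r r0).
rewrite -/phi pre /Hmeas => ->.
have -> : \prod_(i < (2 * n).+1) s i = r ^+ (2 * n + 2).
  rewrite big_ord_recr/= {2}/s ltnn exprD; congr (_ * _).
  rewrite (eq_bigr (fun=> r)) => [|i _]; last by rewrite /s ltn_ord.
  by rewrite prodr_const card_ord.
by rewrite muleA -EFinM mulfV ?mul1e// gt_eqF// exprn_gt0.
Qed.

(** All coordinates are below 1 in absolute value on the unit ball, so a cube of half-side 2
    contains it. *)
Lemma Hmeas_hunit_lty : (@Hmeas R n hunit < +oo)%E.
Proof.
apply: le_lt_trans (ltry ((2 * 2) ^+ (2 * n).+1)).
rewrite -(lebn_box (2 * n) 2 (ltr0Sn R 1)); apply: lebn_le_measure => v.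
rewrite /hunit/= => hv i ik.
have z0 : 0 <= zabs2 v by apply: sumr_ge0 => j _; rewrite addr_ge0 ?sqr_ge0.
have z1 : zabs2 v < 1.
  rewrite -(ltr_pXn2r (n := 2)) ?nnegrE// expr1n.
  by apply: le_lt_trans hv; rewrite lerDl sqr_ge0.
have sqr2 (x : R) : x ^+ 2 < 1 -> `|x| < 2.
  move=> x1; apply: (@lt_trans _ _ 1); last by rewrite ltr1n.
  by rewrite -(ltr_pXn2r (n := 2)) ?nnegrE// expr1n real_normK ?num_real.
have zj (j : 'I_n) : hx v j ^+ 2 + hy v j ^+ 2 < 1.
  apply: le_lt_trans z1; rewrite /zabs2 (bigD1 j)//= lerDl.
  by apply: sumr_ge0 => k _; rewrite addr_ge0 ?sqr_ge0.
have [i_n|n_i] := ltnP i n.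
  by apply: sqr2; apply: le_lt_trans (zj (Ordinal i_n)); rewrite lerDl sqr_ge0.
have [i_2n|n2_i] := ltnP i (2 * n).
  have i_n : (i - n < n)%N by lia.
  have := zj (Ordinal i_n); rewrite /hy/= subnKC// => zi.
  by apply: sqr2; apply: le_lt_trans zi; rewrite lerDr sqr_ge0.
have -> : i = (2 * n)%N by lia.
by apply: sqr2; apply: le_lt_trans hv; rewrite lerDr sqr_ge0.
Qed.

Lemma Hmeas_hunit_gt0 : (0 < @Hmeas R n hunit)%E.
Proof.
(* On the cube of half-side [e], [zabs2] is at most [2 n e^2 <= e] because [2 n e + 2 e = 1]; then
   [zabs2^2 + t^2 <= 2 e^2 < 1]. *)
pose e : R := (2 * n + 2)%:R^-1.
have m0 : 0 < (2 * n + 2)%:R :> R by rewrite ltr0n addn2.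
have e0 : 0 < e by rewrite invr_gt0.
have ne : 2 * n%:R * e + 2 * e = 1.
  by rewrite -mulrDl -natrM -natrD mulfV// gt_eqF.
have n0 : 0 <= n%:R :> R by [].
have e1 : 2 * e <= 1 by nra.
apply: (@lt_le_trans _ _ ((2 * e) ^+ (2 * n).+1)%:E).
  by rewrite lte_fin exprn_gt0 ?mulr_gt0.
rewrite -(lebn_box (2 * n) e e0); apply: lebn_le_measure => v /= hv.
have sqe (i : nat) : (i <= 2 * n)%N -> coord v i ^+ 2 <= e ^+ 2.
  move=> /hv vi; rewrite -(real_normK (num_real (coord v i))).
  by rewrite ler_pXn2r ?nnegrE// ltW.
have z0 : 0 <= zabs2 v by apply: sumr_ge0 => j _; rewrite addr_ge0 ?sqr_ge0.
have ze : zabs2 v <= e.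
  apply: (@le_trans _ _ (\sum_(j < n) (e ^+ 2 + e ^+ 2))).
    apply: ler_sum => j _; have := ltn_ord j => jn.
    by apply: lerD; apply: sqe; lia.
  rewrite sumr_const card_ord -mulr_natl; nra.
have te : ht v ^+ 2 <= e ^+ 2 by exact: sqe.
have : zabs2 v ^+ 2 <= e ^+ 2 by rewrite ler_pXn2r ?nnegrE// ltW.
rewrite /hunit/=; nra.
Qed.

Definition hunit_vol : R := fine (@Hmeas R n hunit).

Lemma hunit_vol_gt0 : 0 < hunit_vol.
Proof. by rewrite /hunit_vol fine_gt0 // Hmeas_hunit_gt0 Hmeas_hunit_lty. Qed.

Lemma bmeasE u r : 0 < r -> bmeas u r = r ^+ (2 * n + 2) * hunit_vol.
Proof. by move=> r0; rewrite /bmeas Hmeas_hball// fineM// ge0_fin_numE ?Hmeas_hunit_lty// ltW ?Hmeas_hunit_gt0. Qed.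

Lemma Hmeas_hballE u r : 0 < r -> @Hmeas R n (hball u r) = (bmeas u r)%:E.
Proof.
move=> r0; rewrite bmeasE// Hmeas_hball// EFinM fineK//.
by rewrite ge0_fin_numE ?Hmeas_hunit_lty// ltW ?Hmeas_hunit_gt0.
Qed.

Lemma bmeas_gt0 u r : 0 < r -> 0 < bmeas u r.
Proof. by move=> r0; rewrite bmeasE// mulr_gt0 ?exprn_gt0 ?hunit_vol_gt0. Qed.

End Heisenberg_balls.

(** * The weak-type estimate *)

Section weak_type.
Context {R : realType} {n : nat}.
Variables (V : Hn R n -> R) (kappa theta : R) (N : nat).
Hypothesis rho_gt0 : forall u, 0 < crit_rad V u.
Hypothesis kappa01 : 0 < kappa < 1.
Hypothesis theta0N : 0 <= theta <= N%:R.
Implicit Types (f : Hn R n -> R) (u v : Hn R n) (r : R).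

Local Notation Hint f B := (integral (@Hmeas R n) B (fun x => (`|f x|)%:E)).

Lemma hball_le u r r' : r <= r' -> hball u r `<=` hball u r'.
Proof. by move=> rr' v; rewrite /hball/= => /lt_le_trans; apply. Qed.

Lemma one_le_rho u r : 0 < r -> 1 <= 1 + r / crit_rad V u.
Proof. by move=> r0; rewrite lerDl divr_ge0// ltW. Qed.

Lemma one_rho_gt0 u r : 0 < r -> 0 < 1 + r / crit_rad V u.
Proof. by move=> /(one_le_rho u); apply: lt_le_trans. Qed.

Lemma integral_abs_ge0 f (B : set (Hn R n)) : (0 <= Hint f B)%E.
Proof. by apply: integral_ge0 => x _; rewrite lee_fin. Qed.

Lemma Lnorm_rho_ge0 f : (0 <= Lnorm_rho V kappa theta f)%E.
Proof.
pose u0 : Hn R n := of_coord (2 * n) (fun=> 0).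
apply: (@le_trans _ _ (((1 + 1 / crit_rad V u0) `^ (- theta) * bmeas u0 1 `^ (- kappa))%:E *
         Hint f (hball u0 1)))%E.
  by apply: mule_ge0; [rewrite lee_fin mulr_ge0 ?powR_ge0|exact: integral_abs_ge0].
by apply: ereal_sup_ubound; exists u0, 1; split.
Qed.

Lemma integral_hball_le f (A : R) u r : 0 < r ->
  (Lnorm_rho V kappa theta f <= A%:E)%E ->
  (Hint f (hball u r) <=
    (A * ((1 + r / crit_rad V u) `^ theta * bmeas u r `^ kappa))%:E)%E.
Proof.
move=> r0 fA; set c := _ `^ theta * _.
have c0 : 0 < c by rewrite mulr_gt0 ?powR_gt0 ?one_rho_gt0 ?bmeas_gt0.
have : (c^-1%:E * Hint f (hball u r) <= A%:E)%E.
  apply: le_trans fA; apply: ereal_sup_ubound; exists u, r; split => //.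
  by rewrite /c invfM -!powRN.
by rewrite muleC lee_pdivrMr// => /le_trans; apply; rewrite EFinM.
Qed.

Lemma Mrho_gtP f u (lam : R) : (lam%:E < `|Mrho V N f u|)%E ->
  exists2 r, 0 < r &
    (lam%:E < (((1 + r / crit_rad V u) ^- N) * (bmeas u r)^-1)%:E * Hint f (hball u r))%E.
Proof.
have M0 : (0 <= Mrho V N f u)%E.
  apply: (@le_trans _ _ ((((1 + 1 / crit_rad V u) ^- N) * (bmeas u 1)^-1)%:E *
     Hint f (hball u 1))%E).
    apply: mule_ge0; last exact: integral_abs_ge0.
    by rewrite lee_fin mulr_ge0 ?invr_ge0 ?exprn_ge0 ?ltW ?bmeas_gt0 ?one_rho_gt0.
  by apply: ereal_sup_ubound; exists 1; split.
by rewrite gee0_abs// => /ereal_sup_gt[_ [r [r0 ->]] lr]; exists r.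
Qed.

(** The damping factor [(1 + r / rho(u))^-N] is at most 1, so dropping it leaves a lower bound on
    the plain average. *)
Lemma average_gt f u r (lam : R) : 0 < r ->
  (lam%:E < (((1 + r / crit_rad V u) ^- N) * (bmeas u r)^-1)%:E * Hint f (hball u r))%E ->
  (lam%:E * @Hmeas R n (hball u r) <= Hint f (hball u r))%E.
Proof.
move=> r0 lr; have b0 := bmeas_gt0 u r r0.
rewrite Hmeas_hballE// -lee_pdivlMr// muleC; apply: le_trans (ltW lr) _.
apply: lee_wpmul2r; first exact: integral_abs_ge0.
rewrite lee_fin ger_pMl ?invr_gt0// invf_le1 ?exprn_gt0 ?one_rho_gt0//.
exact: exprn_ege1 (one_le_rho _ _ r0).
Qed.

(** The volume depends on the radius alone, so the center may change; the negative exponent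
    [kappa - 1] reverses the order. *)
Lemma bmeas_powR_le u v r r' : 0 < r -> r <= r' ->
  bmeas u r' `^ (kappa - 1) <= bmeas v r `^ (kappa - 1).
Proof.
move=> r0 rr'; have r'0 := lt_le_trans r0 rr'.
rewrite -(opprB 1 kappa) !powRN lef_pV2 ?posrE ?powR_gt0 ?bmeas_gt0//.
apply: ge0_ler_powR; rewrite ?nnegrE ?(ltW (bmeas_gt0 _ _ _))//.
  by case/andP: kappa01 => _ k1; rewrite subr_ge0 ltW.
by rewrite !bmeasE// ler_pM2r ?hunit_vol_gt0//; apply: lerXn2r; rewrite ?nnegrE// ltW.
Qed.

(** The Morrey weight and the damping factor are both centered at [u]; they combine to
    [(1 + r / rho(u))^(theta - N) <= 1]. *)
Lemma large_radius_bound f (A : R) u r (lam : R) : 0 < r -> 0 <= A ->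
  (Lnorm_rho V kappa theta f <= A%:E)%E ->
  (lam%:E < (((1 + r / crit_rad V u) ^- N) * (bmeas u r)^-1)%:E * Hint f (hball u r))%E ->
  lam < A * bmeas u r `^ (kappa - 1).
Proof.
move=> r0 A0 fA lr; rewrite -lte_fin; apply: lt_le_trans lr _.
have b0 := bmeas_gt0 u r r0.
set x := 1 + _; have x1 : 1 <= x := one_le_rho u r r0.
have x0 : 0 < x := lt_le_trans ltr01 x1.
apply: le_trans (lee_wpmul2l _ (integral_hball_le f A u r r0 fA)) _.
  by rewrite lee_fin mulr_ge0 ?invr_ge0 ?exprn_ge0 ?ltW.
rewrite -EFinM lee_fin mulrCA; apply: ler_wpM2l => //.
rewrite -/x powRD; last by rewrite (gt_eqF b0) implybT.
rewrite powR_inv1 ?(ltW b0)// mulrACA [(bmeas u r)^-1 * _]mulrC.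
apply: ler_piMl; first by rewrite mulr_ge0 ?powR_ge0 ?invr_ge0 ?ltW.
rewrite mulrC ler_pdivrMr ?exprn_gt0// mul1r -powR_mulrn ?(ltW x0)//.
by apply: ler_powR => //; case/andP: theta0N.
Qed.

(** The power of 6 is the volume cost of the Vitali enlargement; the other two factors pay for
    passing from [B(u0, 4r)] back to [B(u0, r)] in the Morrey weight. *)
Definition weak_const : R :=
  6%:R ^+ (2 * n + 2) * (4%:R `^ theta * (4%:R ^+ (2 * n + 2)) `^ kappa).

(** This lets the same constant serve for small [lam], where the trivial estimate is used. *)
Lemma weak_const_ge1 : 1 <= weak_const.
Proof.
have k0 : 0 <= kappa by case/andP: kappa01 => /ltW.
have t0 : 0 <= theta by case/andP: theta0N.
have h (x a : R) : 1 <= x -> 0 <= a -> 1 <= x `^ a.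
  by move=> x1 a0; rewrite -[leLHS](powRr0 x); apply: ler_powR.
rewrite /weak_const -[leLHS]mulr1; apply: ler_pM => //; first by rewrite exprn_ege1// ler1n.
rewrite -[leLHS]mulr1; apply: ler_pM => //; apply: h => //; first by rewrite ler1n.
by rewrite exprn_ege1// ler1n.
Qed.

Lemma large_ball_const u r : 0 < r ->
  6%:R ^+ (2 * n + 2) * ((1 + 4%:R * r / crit_rad V u) `^ theta * bmeas u (4%:R * r) `^ kappa)
  <= weak_const * ((1 + r / crit_rad V u) `^ theta * bmeas u r `^ kappa).
Proof.
move=> r0; have x0 := one_rho_gt0 u r r0; have b0 := bmeas_gt0 u r r0.
have t0 : 0 <= theta by case/andP: theta0N.
rewrite /weak_const -[leRHS]mulrA; apply: ler_wpM2l; first by rewrite exprn_ge0.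
rewrite [leRHS]mulrACA; apply: ler_pM; rewrite ?powR_ge0//.
  rewrite -powRM ?(ltW x0)//; apply: ge0_ler_powR => //; rewrite ?nnegrE.
  - by rewrite ltW// one_rho_gt0// mulr_gt0.
  - by rewrite mulr_ge0// ltW.
  - by rewrite mulrDr mulr1 mulrA lerD2r ler1n.
by rewrite -powRM ?exprn_ge0 ?(ltW b0)// !bmeasE ?mulr_gt0// exprMn mulrA.
Qed.

Lemma small_radii_bound f (E : set (Hn R n)) (rad : Hn R n -> R) u0 r (lam : R) :
  measurable_fun setT f -> 0 < r -> 0 <= lam -> E `<=` hball u0 r ->
  (forall u, E u -> 0 < rad u <= r) ->
  (forall u, E u ->
     lam%:E * @Hmeas R n (hball u (rad u)) <= Hint f (hball u (rad u)))%E ->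
  (lam%:E * @Hmeas R n E <=
     (6%:R ^+ (2 * n + 2))%:E * Hint f (hball u0 (4%:R * r)))%E.
Proof.
move=> mf r0 lam0 EB radE avg.
pose B u := hball u (rad u); pose B' u := hball u (6%:R * rad u).
have rad0 u : E u -> 0 < rad u by move=> /radE/andP[].
have r40 : 0 < 4%:R * r by rewrite mulr_gt0.
have BX u : E u -> B u `<=` hball u0 (4%:R * r).
  (* The quasi-triangle inequality gives the radius [2 (r + rad u) <= 4 r]. *)
  move=> Eu v uv; have := hball_trans u0 u v r (rad u) r0 (rad0 u Eu) (EB _ Eu) uv.
  by apply: hball_le; case/andP: (radE _ Eu); lra.
have [D [DE tD cov]] := @vitali_disjoint_subfamily R _ _ B rad E r radE
  (fun u Eu => ex_intro _ u (hball_center u (rad u) (rad0 u Eu))).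
have mX := measurable_hball u0 _ r40.
have cD : countable D.
  apply: (@countable_disjoint_positive _ _ R (msp_mu (lebn R (2 * n))) (msp_car (lebn R (2 * n)))
    D B _ mX _ tD).
    by have := ltry (bmeas u0 (4%:R * r)); rewrite -Hmeas_hballE.
  move=> u /DE Eu; split; [exact: measurable_hball (rad0 _ Eu)|exact: BX|].
  suff : (0 < @Hmeas R n (B u))%E by [].
  by rewrite Hmeas_hballE ?rad0// lte_fin bmeas_gt0 ?rad0.
have [mU bU] : measurable (\bigcup_(u in D) B' u) /\
    (lam%:E * @Hmeas R n (\bigcup_(u in D) B' u) <=
     (6%:R ^+ (2 * n + 2))%:E * Hint f (hball u0 (4%:R * r)))%E.
  apply: (@disjoint_family_bound _ _ R (msp_mu (lebn R (2 * n))) (msp_car (lebn R (2 * n)))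
    D B B') => // [u /DE Eu|].
  - have r60 : 0 < 6%:R * rad u by rewrite mulr_gt0 ?rad0.
    split.
    + exact: measurable_hball (rad0 _ Eu).
    + exact: measurable_hball.
    + exact: BX.
    + suff : (@Hmeas R n (B' u) <= (6%:R ^+ (2 * n + 2))%:E * @Hmeas R n (B u))%E by [].
      rewrite !Hmeas_hballE ?rad0// !bmeasE ?rad0//.
      by rewrite -EFinM exprMn mulrA.
    + exact: avg.
  - by apply/measurable_EFinP; apply: measurableT_comp.
apply: le_trans bU; apply: lee_wpmul2l; first by rewrite lee_fin.
apply: lebn_le_measure => u Eu; have [v [Dv [w [uw vw]] rr]] := cov u Eu.
have v0 := rad0 _ (DE _ Dv).
(* The ball of [u] meets the selected ball of [v] at [w], and [rad u <= 2 * rad v]; so [u] lies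
   within [2 (rad v + 2 rad v) = 6 rad v] of [v]. *)
exists v => //; have v20 : 0 < 2 * rad v by rewrite mulr_gt0.
have wu : hball w (2 * rad v) u by apply: hball_sym => //; apply: hball_le uw.
rewrite /B'; have := hball_trans v w u _ _ v0 v20 vw wu.
by apply: hball_le; lra.
Qed.

End weak_type.

(** * Positivity of the critical radius and the final bound *)

Lemma crit_rad_ge0 {R : realType} {n : nat} (V : Hn R n -> R) (u : Hn R n) :
  0 <= crit_rad V u.
Proof.
rewrite /crit_rad; set S := [set r : R | _].
(* For a set that is empty or unbounded above, [sup] takes the default value 0. *)
have [[[x Sx] ubS]|nS] := pselect (has_sup S); last by rewrite sup_out.
by apply: le_trans (ub_le_sup ubS Sx); case: Sx => /ltW.
Qed.

(* A junk value [crit_rad V u = 0] would make the ratio [0 / 0 = 0] violate the lower bound. *)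
Lemma crit_rad_gt0 {R : realType} {n : nat} (V : Hn R n -> R) (N0 C0 : R) :
  1 <= C0 ->
  (forall u v : Hn R n,
     C0^-1 * (1 + hnorm (hmul (hinv v) u) / crit_rad V u) `^ (- N0)
       <= crit_rad V v / crit_rad V u) ->
  forall u, 0 < crit_rad V u.
Proof.
move=> C01 cmp u; rewrite lt_neqAle crit_rad_ge0 andbT eq_sym.
apply/eqP => u0; have := cmp u u; rewrite u0 invr0 !mulr0 addr0 powR1 mulr1.
by apply/negP; rewrite -ltNge invr_gt0 (lt_le_trans ltr01).
Qed.

Lemma Mrho_level_set {R : realType} {n : nat} (V : Hn R n -> R) (kappa theta : R) (N : nat)
    (f : Hn R n -> R) (A lam : R) (u0 : Hn R n) (r : R) :
  (forall u, 0 < crit_rad V u) -> 0 < kappa < 1 -> 0 <= theta <= N%:R ->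
  measurable_fun setT f -> 0 <= A -> (Lnorm_rho V kappa theta f <= A%:E)%E ->
  0 < r -> 0 < lam ->
  (lam%:E * @Hmeas R n [set u | hball u0 r u /\ (lam%:E < `|Mrho V N f u|)%E] <=
   (@weak_const R n kappa theta *
     (A * ((1 + r / crit_rad V u0) `^ theta * bmeas u0 r `^ kappa)))%:E)%E.
Proof.
move=> rho0 k01 tN mf A0 fA r0 lam0; set E := [set u | _].
have b0 := bmeas_gt0 u0 r r0; have x0 := one_rho_gt0 V rho0 u0 r r0.
have t0 : 0 <= theta by case/andP: tN.
have EB : E `<=` hball u0 r by move=> u [].
(* The threshold bounds every [lam] that a radius of at least [r] can detect. *)
have [small|large] := leP lam (A * bmeas u0 r `^ (kappa - 1)).
  apply: (@le_trans _ _ (lam * bmeas u0 r)%:E).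
    rewrite EFinM -Hmeas_hballE//; apply: lee_wpmul2l; first by rewrite lee_fin ltW.
    exact: lebn_le_measure.
  rewrite lee_fin; apply: (@le_trans _ _ (A * bmeas u0 r `^ kappa)).
    apply: le_trans (ler_wpM2r (ltW b0) small) _.
    rewrite -mulrA powRD; last by rewrite (gt_eqF b0) implybT.
    by rewrite powR_inv1 ?(ltW b0)// -[_ * _ * bmeas _ _]mulrA mulVf ?mulr1// gt_eqF.
  have W1 := weak_const_ge1 (n := n) kappa theta N k01 tN.
  have x1 : 1 <= (1 + r / crit_rad V u0) `^ theta.
    by rewrite -[leLHS](powRr0 (1 + r / crit_rad V u0)); apply: ler_powR => //; exact: one_le_rho.
  rewrite [leRHS]mulrCA; apply: ler_wpM2l => //.
  rewrite mulrA; apply: ler_peMl; first exact: powR_ge0.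
  by rewrite -[leLHS]mulr1; apply: ler_pM.
(* One radius is selected for each point of the level set; off that set the value 0 is a
   placeholder. *)
have /choice[rad radP] : forall u, exists s, E u -> 0 < s <= r /\
    (lam%:E * @Hmeas R n (hball u s) <=
     \int[@Hmeas R n]_(x in hball u s) (`|f x|)%:E)%E.
  move=> u; have [Eu|nE] := pselect (E u); last by exists 0.
  have [s s0 ls] := Mrho_gtP V N rho0 f u lam Eu.2.
  exists s => _; split; last exact: (average_gt V N rho0 f u s lam s0 ls).
  (* A radius [s > r] would force [lam < A |B(u, s)|^(kappa - 1) <= A |B(u0, r)|^(kappa - 1)],
     contradicting [large]. *)
  rewrite s0 leNgt/=; apply/negP => rs.
  have := large_radius_bound V kappa theta N rho0 tN f A u s lam s0 A0 fA ls.
  apply/negP; rewrite -leNgt; apply: ltW; apply: le_lt_trans large.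
  by apply: ler_wpM2l => //; exact: (bmeas_powR_le kappa k01 u u0 r s r0 (ltW rs)).
apply: le_trans (small_radii_bound f E rad u0 r lam mf r0 (ltW lam0) EB
  (fun u Eu => (radP u Eu).1) (fun u Eu => (radP u Eu).2)) _.
have r40 : 0 < 4%:R * r by rewrite mulr_gt0.
apply: le_trans (lee_wpmul2l _ (integral_hball_le V kappa theta rho0 f A u0 _ r40 fA)) _.
  by rewrite lee_fin exprn_ge0.
rewrite -EFinM lee_fin mulrCA [leRHS]mulrCA; apply: ler_wpM2l => //.
exact: (large_ball_const V kappa theta N rho0 tN u0 r r0).
Qed.

Theorem theorem3p4 (R : realType) (n : nat) (V : Hn R n -> R) (s : R)
    (N0 C0 : R) (kappa : R) (N : nat) (theta : R) :
  (0 < n)%N ->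
  (* V >= 0, locally integrable, not identically zero (a.e.) *)
  (forall x, 0 <= V x) ->
  measurable_fun setT V ->
  (forall (u : Hn R n) (r : R), 0 < r ->
     (@Hmeas R n).-integrable (hball u r) (fun x => (V x)%:E)) ->
  ~ ({ae @Hmeas R n, forall x, V x = 0}) ->
  (* V in RH_s with s >= Q/2 *)
  Qdim R n / 2 <= s -> RH s V ->
  (* N0, C0 : the constants of the comparison estimate for rho *)
  0 < N0 -> 1 <= C0 ->
  (forall u v : Hn R n,
     C0^-1 * (1 + hnorm (hmul (hinv v) u) / crit_rad V u) `^ (- N0)
       <= crit_rad V v / crit_rad V u /\
     crit_rad V v / crit_rad V u
       <= C0 * (1 + hnorm (hmul (hinv v) u) / crit_rad V u) `^ (N0 / (N0 + 1))) ->
  (* p = 1, 0 < kappa < 1, 0 < theta (N0+1) <= N *)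
  0 < kappa < 1 ->
  0 < theta * (N0 + 1) <= N%:R ->
  exists C : R, 0 < C /\
    forall f : Hn R n -> R, measurable_fun setT f ->
      (Lnorm_rho V kappa theta f < +oo)%E ->
      (WLnorm_rho V kappa theta (Mrho V N f) <= C%:E * Lnorm_rho V kappa theta f)%E.
Proof.
move=> _ _ _ _ _ _ _ N00 C01 cmp k01 /andP[t0 tN].
have rho0 := crit_rad_gt0 V N0 C0 C01 (fun u v => (cmp u v).1).
have theta0 : 0 < theta by move: t0; rewrite pmulr_lgt0// addr_gt0.
have tN' : 0 <= theta <= N%:R.
  (* Since [N0 > 0], [theta <= theta * (N0 + 1) <= N]. *)
  rewrite (ltW theta0)/=; apply: le_trans tN.
  by rewrite ler_peMr ?(ltW theta0)// lerDr ltW.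
have W1 := weak_const_ge1 (n := n) kappa theta N k01 tN'.
exists (@weak_const R n kappa theta); split; first exact: lt_le_trans W1.
move=> f mf foo.
have ffin : Lnorm_rho V kappa theta f \is a fin_num.
  by rewrite ge0_fin_numE ?Lnorm_rho_ge0.
rewrite -(fineK ffin); set A := fine _.
have A0 : 0 <= A by rewrite fine_ge0 ?Lnorm_rho_ge0.
have fA : (Lnorm_rho V kappa theta f <= A%:E)%E by rewrite /A fineK.
apply: ge_ereal_sup => _ [u0 [r [r0 ->]]].
have b0 := bmeas_gt0 u0 r r0; have x0 := one_rho_gt0 V rho0 u0 r r0.
set c := (1 + r / crit_rad V u0) `^ theta * bmeas u0 r `^ kappa.
have c0 : 0 < c by rewrite mulr_gt0 ?powR_gt0.
have -> : (1 + r / crit_rad V u0) `^ (- theta) * bmeas u0 r `^ (- kappa) = c^-1.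
  by rewrite /c invfM -!powRN.
rewrite muleC lee_pdivrMr//.
apply: ge_ereal_sup => _ [lam [lam0 ->]].
rewrite -!EFinM -mulrA; exact: Mrho_level_set.
Qed.
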